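(* Let $k\geq 2$ be an integer. There does not exist a spherical latin bitrade whose canonical group is isomorphic to $\mathbb{Z}_2^k$.
   Context: Partial latin square: given finite, pairwise disjoint sets $R$ (rows), $C$ (columns), $S$ (symbols), a partial latin square is a subset $P\subseteq R\times C\times S$ such that any two distinct triples of $P$ agree in at most one coordinate; it is assumed that every element of $R$, $C$ and $S$ occurs in some triple of $P$. Latin bitrade: an ordered pair $(W,B)$ of non-empty partial latin squares (with common sets $R,C,S$) such that for each triple $(r,c,s)\in W$ (respectively $B$) there exist unique $r'\neq r$, $c'\neq c$, $s'\neq s$ with $\{(r',c,s),(r,c',s),(r,c,s')\}\subset B$ (respectively $W$). Its size is $|W|=|B|$. It is connected if there is no latin bitrade $(W',B')$ with $W'\subsetneq W$ and $B'\subsetneq B$. Separated: for each row $r$, define a permutation $\rho_r$ of the symbols in row $r$ by $\rho_r(s)=s'$ if and only if $(r,c,s)\in W$ and $(r,c,s')\in B$ for some $c\in C$; the row $r$ is separated if $\rho_r$ is a single cycle. Separated columns and symbols are defined analogously. The bitrade is separated if every row, column and symbol is separated. Spherical: from a connected separated latin bitrade $(W,B)$ construct a face two-coloured triangulation of a closed orientable surface with vertex set $R\sqcup C\sqcup S$, with an edge between two vertices if and only if they occur together in a triple of $W$ (equivalently of $B$), a white triangular face with vertices $r,c,s$ for each $(r,c,s)\in W$, and a black triangular face with vertices $r,c,s$ for each $(r,c,s)\in B$. A spherical latin bitrade is a connected separated latin bitrade for which this surface is the sphere (equivalently, a connected latin bitrade with $|R|+|C|+|S|=|W|+2$). Canonical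 group: for a partial latin square $P$ with sets $R,C,S$, let $\mathcal{A}_P$ be the abelian group with generating set $R\cup C\cup S$ subject to the relations $r+c+s=0$ for all $(r,c,s)\in P$. It is known that for a spherical latin bitrade $(W,B)$ one has $\mathcal{A}_W\cong\mathcal{A}_B\cong\mathbb{Z}\oplus\mathbb{Z}\oplus\mathcal{C}$ with $\mathcal{C}$ finite. The group $\mathcal{C}$ (the torsion subgroup of $\mathcal{A}_W$) is called the canonical group of $(W,B)$. $\mathbb{Z}_n$ denotes the cyclic group of order $n$. *)

(* Defs.v *)
From HB Require Import structures.
From mathcomp Require Import all_boot all_order all_fingroup all_algebra.
From mathcomp Require Import generic_quotient ring_quotient.
From mathcomp Require Import boolp.

Set Implicit Arguments.
Unset Strict Implicit.
Unset Printing Implicit Defensive.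

Import GRing.Theory.

(* Rows, columns and symbols live in three ambient finite types, so that they
   are automatically disjoint.  The row, column and symbol sets are explicit
   arguments because the definition of connectedness compares a bitrade with
   bitrades whose row, column and symbol sets may be smaller. *)
Section LatinBitrade.
Variables X Y Z : finType.
Implicit Types (R : {set X}) (C : {set Y}) (S : {set Z}).
Implicit Types P W B : {set X * Y * Z}.

Definition agreement (t u : X * Y * Z) : nat :=
  (t.1.1 == u.1.1) + (t.1.2 == u.1.2) + (t.2 == u.2).

Definition partial_latin_square R C S P : Prop :=
  [/\ P \subset setX (setX R C) S,
      {in P &, forall t u, t != u -> agreement t u <= 1},
      forall r, r \in R -> exists c s, (r, c, s) \in P,
      forall c, c \in C -> exists r s, (r, c, s) \in P
    & forall s, s \in S -> exists r c, (r, c, s) \in P].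

Definition has_unique_mates P (Q : {set X * Y * Z}) : Prop :=
  forall r c s, (r, c, s) \in P ->
    [/\ exists! r', r' != r /\ (r', c, s) \in Q,
        exists! c', c' != c /\ (r, c', s) \in Q
      & exists! s', s' != s /\ (r, c, s') \in Q].

Definition latin_bitrade R C S W B : Prop :=
  [/\ partial_latin_square R C S W /\ partial_latin_square R C S B,
      W != set0 /\ B != set0,
      has_unique_mates W B
    & has_unique_mates B W].

Definition connected_bitrade W B : Prop :=
  ~ exists R' C' S' W' B',
      [/\ latin_bitrade R' C' S' W' B', W' \proper W & B' \proper B].

Definition row_symbols W (r : X) : {set Z} :=
  [set s | [exists c, (r, c, s) \in W]].

(* In a latin bitrade there is exactly one such permutation, namely rho_r. *)
Definition is_row_perm W B (r : X) (rho : {perm Z}) : Prop :=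
  perm_on (row_symbols W r) rho /\
  forall s s', s \in row_symbols W r ->
    (rho s = s' <-> exists c, (r, c, s) \in W /\ (r, c, s') \in B).

Definition row_separated W B (r : X) : Prop :=
  exists2 rho, is_row_perm W B r rho &
    exists2 s, s \in row_symbols W r & porbit rho s = row_symbols W r.

End LatinBitrade.

(* Cyclic shift of the roles of rows, columns and symbols. *)
Definition rotate (X Y Z : finType) (P : {set X * Y * Z}) : {set Y * Z * X} :=
  [set (t.1.2, t.2, t.1.1) | t in P].

Section Spherical.
Variables R C S : finType.
Implicit Types P W B : {set R * C * S}.

(* Column c: the permutation of the rows in column c that maps r to r' when
   (r, c, s) is in W and (r', c, s) is in B for some s.
   Symbol s: the permutation of the columns containing s that maps c to c' when
   (r, c, s) is in W and (r, c', s) is in B for some r. *)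
Definition separated_bitrade W B : Prop :=
  [/\ forall r : R, row_separated W B r,
      forall c : C, row_separated (rotate W) (rotate B) c
    & forall s : S, row_separated (rotate (rotate W)) (rotate (rotate B)) s].

Definition vertex : finType := (R + C + S)%type.

Definition row_vertex (r : R) : vertex := inl (inl r).
Definition column_vertex (c : C) : vertex := inl (inr c).
Definition symbol_vertex (s : S) : vertex := inr s.

Definition face (t : R * C * S) : {set vertex} :=
  [set row_vertex t.1.1; column_vertex t.1.2; symbol_vertex t.2].

(* In a latin bitrade no white triple is black, so that these are
   #|W| + #|B| distinct faces. *)
Definition faces W B : {set {set vertex}} := [set face t | t in W :|: B].

Definition edges W : {set {set vertex}} :=
  [set e : {set vertex} | (#|e| == 2) && [exists t in W, e \subset face t]].

(* The triangulated surface of a connected separated bitrade is connected,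
   closed and orientable, so that it is the sphere exactly when its Euler
   characteristic V - E + F is 2. *)
Definition surface_is_sphere W B : Prop :=
  #|vertex| + #|faces W B| = #|edges W| + 2.

Definition spherical_bitrade W B : Prop :=
  [/\ latin_bitrade [set: R] [set: C] [set: S] W B,
      connected_bitrade W B,
      separated_bitrade W B
    & surface_is_sphere W B].

End Spherical.

Local Open Scope ring_scope.

Section CanonicalGroup.
Variables (R C S : finType) (P : {set R * C * S}).

Notation free_group := {ffun vertex R C S -> int}.

Definition generator (v : vertex R C S) : free_group :=
  [ffun w => (w == v)%:R].

Definition relator (t : R * C * S) : free_group :=
  generator (row_vertex C S t.1.1) + generator (column_vertex R S t.1.2)
  + generator (symbol_vertex R C t.2).

Definition relations : {pred free_group} :=
  fun f => `[< exists a : R * C * S -> int,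
                 f = \sum_(t in P) relator t *~ a t >].

Fact relations_zmod_closed : zmod_closed relations.
Proof.
split.
  apply/asboolP; exists (fun=> 0).
  by rewrite big1 // => t _; rewrite mulr0z.
move=> f g /asboolP [a ->] /asboolP [b ->]; apply/asboolP.
exists (fun t => a t - b t); rewrite -sumrB.
by apply: eq_bigr => t _; rewrite mulrzBr.
Qed.

HB.instance Definition _ :=
  GRing.isZmodClosed.Build free_group relations relations_zmod_closed.

Definition presented_group : zmodType := Quotient.quot relations.

Definition torsion : {pred presented_group} :=
  fun x => `[< exists2 n : nat, (0 < n)%N & x *+ n = 0 >].

Fact torsion_zmod_closed : zmod_closed torsion.
Proof.
split; first by apply/asboolP; exists 1%N.
move=> x y /asboolP [m m_gt0 mx0] /asboolP [n n_gt0 ny0]; apply/asboolP.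
exists (m * n)%N; first by rewrite muln_gt0 m_gt0.
by rewrite mulrnBl mulrnA mx0 mul0rn mulnC mulrnA ny0 mul0rn subrr.
Qed.

HB.instance Definition _ :=
  GRing.isZmodClosed.Build presented_group torsion torsion_zmod_closed.

Record canonical_group : Type := CanonicalGroup {
  canonical_val :> presented_group;
  _ : canonical_val \in torsion
}.

HB.instance Definition _ := [isSub for canonical_val].
HB.instance Definition _ := [Choice of canonical_group by <:].
HB.instance Definition _ := [SubChoice_isSubZmodule of canonical_group by <:].

End CanonicalGroup.

Definition zmod_isomorphic (U V : zmodType) : Prop :=
  exists f : {additive U -> V}, bijective f.

(* Main.v *)
(** In a bitrade every edge lies in one white and one black triangle, so the
    vertex-triangle incidence matrices A of W and A' of B have the same Gram
    matrix: A^T A = A'^T A'.  Hence the rows of A' are rational combinations of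
    those of A, i.e. black relators are torsion in the group of W.  If the
    canonical group has exponent 2, then 2 A' = M A for an integer matrix M.
    Connectedness and the Euler characteristic make the rows of A independent,
    so the Gram identity gives M^T M = M M^T = 4, and M^T A' = 2 A.  (Drapal's
    picture: a row of M^T lists the signed side lengths in a dissection of an
    equilateral triangle of side 2, so there can only be 4 of them.)  These
    equations force the nonzero entries of a row or column to be three 1s, at
    the mates of a triple, and one -1, at a triple having the same mates.
    Therefore W contains an intercalate, hence equals it by connectedness, and
    its canonical group has order at most 2. *)

Require Import Defs.
From mathcomp Require Import all_boot all_order all_algebra.
From mathcomp Require Import generic_quotient ring_quotient boolp.
From mathcomp Require Import zify ring.
Set Implicit Arguments.
Unset Strict Implicit.
Unset Printing Implicit Defensive.

Import Order.TTheory GRing.Theory Num.Theory.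
Local Open Scope ring_scope.
Local Open Scope quotient_scope.

(** * Matrices with equal Gram matrices *)

Section LinearAlgebra.
Variable F : realFieldType.

Lemma dotmx_eq0 m (u : 'cV[F]_m) : u^T *m u = 0 -> u = 0.
Proof.
move=> /matrixP/(_ 0 0); rewrite !mxE => /eqP.
rewrite psumr_eq0 => [/allP u0|i _]; last by rewrite !mxE -expr2 sqr_ge0.
apply/matrixP => i j; rewrite ord1 mxE.
by have := u0 i (mem_index_enum i); rewrite /= !mxE mulf_eq0 orbb => /eqP.
Qed.

(** The Gram matrix determines the norm: |Au|^2 = u^T A^T A u = |Bu|^2. *)
Lemma gram_mulmx_eq0 m1 m2 n (A : 'M[F]_(m1, n)) (B : 'M[F]_(m2, n))
    (u : 'cV[F]_n) :
  A^T *m A = B^T *m B -> A *m u = 0 -> B *m u = 0.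
Proof.
move=> gramAB Au0; apply: dotmx_eq0.
by rewrite trmx_mul -mulmxA (mulmxA B^T) -gramAB -mulmxA Au0 !mulmx0.
Qed.

(** The columns of [cokermx A] lie in the kernel of [A], hence in that of [B]; this characterizes
    the inclusion of row spaces. *)
Lemma gram_submx m1 m2 n (A : 'M[F]_(m1, n)) (B : 'M[F]_(m2, n)) :
  A^T *m A = B^T *m B -> (B <= A)%MS.
Proof.
move=> gramAB; rewrite submxE; apply/eqP/matrixP => i j.
have /(gram_mulmx_eq0 gramAB) : A *m col j (cokermx A) = 0.
  by rewrite colE mulmxA mulmx_coker mul0mx.
by rewrite !colE mulmxA -colE => /matrixP/(_ i 0); rewrite !mxE.
Qed.

(** Both sides agree once placed between A^T and A, since (MA)^T (MA) = c^2 B^T B = c^2 A^T A.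
    Independent rows allow A to be cancelled on the right and, after transposing, A^T on the
    left. *)
Lemma gram_coef_orthogonal m1 m2 n (A : 'M[F]_(m1, n)) (B : 'M[F]_(m2, n))
    (M : 'M[F]_(m2, m1)) (c : F) :
  row_free A -> A^T *m A = B^T *m B -> c *: B = M *m A ->
  M^T *m M = (c ^+ 2)%:M.
Proof.
move=> freeA gramAB cB.
have : A^T *m (M^T *m M *m A) = A^T *m ((c ^+ 2)%:M *m A).
  have -> : A^T *m (M^T *m M *m A) = (M *m A)^T *m (M *m A).
    by rewrite trmx_mul !mulmxA.
  rewrite -cB -scalemxAr linearZ /= -scalemxAl scalerA -expr2.
  by rewrite mul_scalar_mx -scalemxAr gramAB.
move/(congr1 trmx); rewrite !(trmx_mul A^T) trmxK => /(row_free_inj freeA).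
by move/trmx_inj/(row_free_inj freeA).
Qed.

Lemma mulmx_scalarC m n (M : 'M[F]_(m, n)) (c : F) :
  m = n -> c != 0 -> M *m M^T = c%:M -> M^T *m M = c%:M.
Proof.
move=> eq_mn; subst n => c0 MMt.
have /mulmx1C : (c^-1 *: M) *m M^T = 1%:M.
  by rewrite -scalemxAl MMt scale_scalar_mx mulVf.
rewrite -scalemxAr => /(congr1 ( *:%R c)).
by rewrite scalerA divff // scale1r scale_scalar_mx mulr1.
Qed.

End LinearAlgebra.

(** * Integral combinations of relators *)

Section Relators.
Variables X Y Z : finType.
Local Notation T := (X * Y * Z)%type.
Local Notation vert := (vertex X Y Z).

(** The value at [relator t] of the homomorphism that extends [f] from the generators to the free
    group. *)
Definition face_sum (K : zmodType) (f : vert -> K) (t : T) : K :=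
  f (row_vertex Y Z t.1.1) + f (column_vertex X Z t.1.2)
  + f (symbol_vertex X Y t.2).

Lemma sum_relator (K : pzRingType) (f : vert -> K) (t : T) :
  \sum_v (relator t v)%:~R * f v = face_sum f t.
Proof.
have delta w : \sum_v ((generator w v)%:~R * f v) = f w.
  rewrite (bigD1 w) //= ffunE eqxx mul1r big1 ?addr0 // => v vw.
  by rewrite ffunE (negbTE vw) mul0r.
rewrite /face_sum -!delta -!big_split /=; apply: eq_bigr => v _.
by rewrite [relator t v]ffunE [X in (X + _)%R]ffunE !rmorphD !mulrDl.
Qed.

Lemma relator_row (t : T) x : relator t (row_vertex Y Z x) = (x == t.1.1)%:R.
Proof. by rewrite !ffunE !eqE /= !eqE /= !addr0. Qed.

Lemma relator_column (t : T) y :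
  relator t (column_vertex X Z y) = (y == t.1.2)%:R.
Proof. by rewrite !ffunE !eqE /= !eqE /= addr0 add0r. Qed.

Lemma relator_symbol (t : T) z :
  relator t (symbol_vertex X Y z) = (z == t.2)%:R.
Proof. by rewrite !ffunE !eqE /= !add0r. Qed.

Definition relatorE := (relator_row, relator_column, relator_symbol).

Lemma relator_ge0 (t : T) v : 0 <= relator t v.
Proof. by rewrite !ffunE !addr_ge0 ?ler0n. Qed.

(** This is the inner product of two rows of incidence matrices. *)
Lemma face_sum_relator (t u : T) : face_sum (relator t) u = (agreement t u)%:R.
Proof.
rewrite /face_sum !relatorE /agreement !natrD.
by rewrite (eq_sym t.1.1) (eq_sym t.1.2) (eq_sym t.2).
Qed.

(** The homomorphism defined by [f] is applied to both sides of the relation. *)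
Lemma sum_relator_coef (P : {set T}) (m : T -> int) (c : int) (a : T)
    (f : vert -> int) :
  \sum_(b in P) relator b *~ m b = relator a *~ c ->
  \sum_(b in P) m b * face_sum f b = c * face_sum f a.
Proof.
move=> rel; rewrite -[face_sum f a]sum_relator mulr_sumr.
under eq_bigr do rewrite -sum_relator mulr_sumr.
rewrite exchange_big; apply: eq_bigr => v _ /=.
move/ffunP/(_ v): rel; rewrite sum_ffunE ffunMzE => rel.
rewrite !intz mulrA (mulrC c) -[relator a v * c]mulrzz -rel mulr_suml.
by apply: eq_bigr => b _; rewrite ffunMzE !intz mulrzz mulrA (mulrC (m b)).
Qed.

(** Integrality matters here: m n <= |m| <= m^2. *)
Lemma mulz_sign_le_sqr (m n : int) : `|n| <= 1 -> m * n <= m ^+ 2.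
Proof.
move=> n1; have [-> | -> | ->] : [\/ n = -1, n = 0 | n = 1].
- by case: (ltrgtP n 0) => n0; [apply: Or31 | apply: Or33 | apply: Or32]; lia.
- by rewrite expr2; nia.
- by rewrite mulr0 sqr_ge0.
- by rewrite expr2; nia.
Qed.

(** * Integral expressions of squared norm 4 for twice a relator *)

Section MinimalCoefficients.
Variables (P : {set T}) (a : T) (m : T -> int).
Hypotheses (aP : a \notin P) (norm_m : \sum_(b in P) m b ^+ 2 = 4).
Hypothesis rel_m : \sum_(b in P) relator b *~ m b = relator a *~ 2.

(** With weight 1 at every vertex each triple has weight 3, so three times the sum is 6. *)
Lemma sum_coef : \sum_(b in P) m b = 2.
Proof.
have := sum_relator_coef (fun=> 1) rel_m.
rewrite -mulr_suml /face_sum /=; set s := \sum_(_ in _) _; lia.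
Qed.

Lemma agreement_le2 b : b \in P -> (agreement a b <= 2)%N.
Proof.
move=> bP; have: b != a by apply: contraNneq aP => <-.
case: a b {bP} => [[x y] z] [[x' y'] z']; rewrite /agreement !xpair_eqE /=.
by rewrite (eq_sym x) (eq_sym y) (eq_sym z); do 3!case: (_ == _).
Qed.

(* The numbers [(agreement - 1) m] sum to 4 = [sum m^2], although each of them
   is at most [m^2]; hence they all attain this bound. *)
Lemma coef_sqr b : b \in P -> m b ^+ 2 = m b * ((agreement a b)%:R - 1).
Proof.
have bound b' : b' \in P ->
    0 <= m b' ^+ 2 - m b' * ((agreement a b')%:R - 1).
  move=> /agreement_le2 le2; rewrite subr_ge0 mulz_sign_le_sqr //.
  by case: agreement le2 => [|[|[|]]].
have : \sum_(b' in P) (m b' ^+ 2 - m b' * ((agreement a b')%:R - 1)) = 0.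
  (* Pairing the relation with [relator a] gives 2 * 3 = 6 for the sum of [m] times [agreement];
     subtracting the coefficient sum 2 leaves 4. *)
  under eq_bigr do rewrite mulrBr mulr1 -face_sum_relator.
  rewrite !sumrB norm_m sum_coef (sum_relator_coef _ rel_m).
  by rewrite face_sum_relator /agreement !eqxx.
move/eqP; rewrite psumr_eq0 // => /allP sum0 bP.
by have := sum0 b (mem_index_enum b); rewrite bP subr_eq0 => /eqP.
Qed.

(** A nonzero coefficient equals [agreement] - 1, which lies in {-1, 0, 1}; a positive one is
    therefore 1, a negative one -1. *)
Lemma coef_pos b : b \in P -> 0 < m b -> agreement a b = 2%N.
Proof.
move=> bP; move: (agreement_le2 bP) (coef_sqr bP); rewrite expr2.
by case: agreement => [|[|[|]]] //=; nia.
Qed.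

Lemma coef_neg b : b \in P -> m b < 0 -> agreement a b = 0%N.
Proof.
move=> bP; move: (agreement_le2 bP) (coef_sqr bP); rewrite expr2.
by case: agreement => [|[|[|]]] //=; nia.
Qed.

(** Otherwise all coefficients are 0 or 1 and equal their squares, although the sums are 2 and 4. *)
Lemma exists_coef_neg : exists2 q, q \in P & m q < 0.
Proof.
case: (boolP [exists q in P, m q < 0]) => [/exists_inP //|/exists_inPn neg].
suff: \sum_(b in P) m b ^+ 2 = \sum_(b in P) m b by rewrite norm_m sum_coef.
apply: eq_bigr => b bP; move: (neg b bP) (coef_sqr bP) (agreement_le2 bP).
by rewrite expr2; case: agreement => [|[|[|]]] //=; nia.
Qed.

(** At a vertex outside [a] the contributions cancel, so the negative one of [q] needs a positive
    one to balance it. *)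
Lemma vertex_coef_pos q v : q \in P -> m q < 0 -> relator a v = 0 ->
  0 < relator q v -> exists2 b, b \in P & (0 < m b) && (0 < relator b v).
Proof.
move=> qP mq_lt0 av0 qv.
have sum0 : \sum_(b in P) m b * relator b v = 0.
  move/ffunP/(_ v): rel_m; rewrite sum_ffunE ffunMzE av0 mul0rz => sum0.
  by rewrite -[RHS]sum0; apply: eq_bigr => b _; rewrite ffunMzE mulrzz mulrC.
case: (boolP [exists b in P, (0 < m b) && (0 < relator b v)]).
  by move=> /exists_inP.
move=> /exists_inPn nonpos; suff: \sum_(b in P) m b * relator b v < 0.
  by rewrite sum0.
rewrite (bigD1 q) //= -[ltRHS]addr0 ltr_leD ?nmulr_rlt0 //.
apply: sumr_le0 => b /andP[/nonpos]; rewrite negb_and -!leNgt.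
move=> /orP[mb|bv] _; first by rewrite mulr_le0_ge0 ?relator_ge0.
by have /eqP -> : relator b v == 0; rewrite ?mulr0 // eq_le bv relator_ge0.
Qed.

(** A negative triple shares no coordinate with [a]. At each of its vertices there is a triple with
    positive coefficient, which agrees with [a] in two coordinates; its third coordinate is then
    that vertex. *)
Lemma coef_neg_mates r c s r' c' s' : a = (r, c, s) ->
  (r', c', s') \in P -> m (r', c', s') < 0 ->
  [/\ r' != r, c' != c & s' != s] /\
  [/\ (r', c, s) \in P, (r, c', s) \in P & (r, c, s') \in P].
Proof.
move=> def_a qP mq_lt0; have := coef_neg qP mq_lt0.
rewrite def_a /agreement /=.
have [//|r'r] := eqVneq r r'; have [//|c'c] := eqVneq c c'.
have [//|s's _] := eqVneq s s'; split=> //.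
have at_vertex v : relator (r, c, s) v = 0 -> 0 < relator (r', c', s') v ->
    exists b, [/\ b \in P, agreement (r, c, s) b = 2%N & 0 < relator b v].
  rewrite -def_a => av0 qv.
  have [b bP /andP[mb bv]] := vertex_coef_pos qP mq_lt0 av0 qv.
  by exists b; rewrite coef_pos.
split.
- have [||[[x y] z] [bP agr]] := at_vertex (row_vertex Y Z r').
  + by rewrite relator_row eq_sym (negbTE r'r).
  + by rewrite relator_row eqxx.
  rewrite relator_row /=; case: eqVneq => // def_x _.
  move: agr bP; rewrite -def_x /agreement /= (negbTE r'r).
  by have [<-|//] := eqVneq c y; have [<-|//] := eqVneq s z.
- have [||[[x y] z] [bP agr]] := at_vertex (column_vertex X Z c').
  + by rewrite relator_column eq_sym (negbTE c'c).
  + by rewrite relator_column eqxx.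
  rewrite relator_column /=; case: eqVneq => // def_y _.
  move: agr bP; rewrite -def_y /agreement /= (negbTE c'c).
  by have [<-|//] := eqVneq r x; have [<-|//] := eqVneq s z.
- have [||[[x y] z] [bP agr]] := at_vertex (symbol_vertex X Y s').
  + by rewrite relator_symbol eq_sym (negbTE s's).
  + by rewrite relator_symbol eqxx.
  rewrite relator_symbol /=; case: eqVneq => // def_z _.
  move: agr bP; rewrite -def_z /agreement /= (negbTE s's).
  by have [<-|//] := eqVneq r x; have [<-|//] := eqVneq c y.
Qed.

End MinimalCoefficients.

End Relators.

(** * Latin bitrades *)

Section Bitrades.
Variables X Y Z : finType.
Local Notation T := (X * Y * Z)%type.

Lemma agreement_inj R C S (P : {set T}) (t u : T) :
  partial_latin_square R C S P -> t \in P -> u \in P ->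
  (2 <= agreement t u)%N -> t = u.
Proof.
case=> _ agr _ _ _ tP uP; case: (eqVneq t u) => // tu.
by move=> /leq_trans/(_ (agr _ _ tP uP tu)).
Qed.

Lemma latin_bitrade_sym R C S (W B : {set T}) :
  latin_bitrade R C S W B -> latin_bitrade R C S B W.
Proof. by case=> -[? ?] [? ?] ? ?; split. Qed.

Variables (R : {set X}) (C : {set Y}) (S : {set Z}) (W B : {set T}).
Hypothesis bWB : latin_bitrade R C S W B.

Lemma bitrade_mates r c s : (r, c, s) \in W ->
  [/\ exists2 r', r' != r & (r', c, s) \in B,
      exists2 c', c' != c & (r, c', s) \in B
    & exists2 s', s' != s & (r, c, s') \in B].
Proof.
case: bWB => _ _ mates _ /mates[[r' [[? ?] _]] [c' [[? ?] _]] [s' [[? ?] _]]].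
by split; [exists r' | exists c' | exists s'].
Qed.

(** A common triple and its symbol mate would be distinct triples of [B] with the same row and
    column. *)
Lemma bitrade_disjoint t : t \in W -> t \notin B.
Proof.
case: t => [[r c] s] tW; apply/negP => tB.
have [_ _ [s' /negP s's s'B]] := bitrade_mates tW; apply: s's.
case: bWB => -[_ plsB] _ _ _.
have [] // : (r, c, s) = (r, c, s').
  by apply: (agreement_inj plsB) => //; rewrite /agreement /= !eqxx.
by move=> ->.
Qed.

End Bitrades.

(** * Projections to pairs of coordinates: the edges shared by white and black triples *)

Definition row_column (X Y Z : finType) (t : X * Y * Z) := (t.1.1, t.1.2).
Definition row_symbol (X Y Z : finType) (t : X * Y * Z) := (t.1.1, t.2).
Definition column_symbol (X Y Z : finType) (t : X * Y * Z) := (t.1.2, t.2).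

Section PairCoordinates.
Variables X Y Z : finType.
Variables (R : {set X}) (C : {set Y}) (S : {set Z}).
Implicit Types W B P : {set X * Y * Z}.

Lemma coordinates_inj P : partial_latin_square R C S P ->
  [/\ {in P &, injective (@row_column X Y Z)},
      {in P &, injective (@row_symbol X Y Z)}
    & {in P &, injective (@column_symbol X Y Z)}].
Proof.
move=> plsP; split=> -[[x y] z] [[x' y'] z'] tP uP [e1 e2];
  apply: (agreement_inj plsP) => //; rewrite /agreement /= e1 e2 !eqxx;
  by case: (_ == _).
Qed.

Lemma coordinates_subset W B : latin_bitrade R C S W B ->
  [/\ @row_column X Y Z @: W \subset @row_column X Y Z @: B,
      @row_symbol X Y Z @: W \subset @row_symbol X Y Z @: B
    & @column_symbol X Y Z @: W \subset @column_symbol X Y Z @: B].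
Proof.
move=> bWB; split; apply/subsetP => _ /imsetP[[[x y] z] tW ->];
  have [[x' _ B1] [y' _ B2] [z' _ B3]] := bitrade_mates bWB tW.
- by apply/imsetP; exists (x, y, z').
- by apply/imsetP; exists (x, y', z).
- by apply/imsetP; exists (x', y, z).
Qed.

Lemma bitrade_coordinates W B : latin_bitrade R C S W B ->
  [/\ @row_column X Y Z @: W = @row_column X Y Z @: B,
      @row_symbol X Y Z @: W = @row_symbol X Y Z @: B
    & @column_symbol X Y Z @: W = @column_symbol X Y Z @: B].
Proof.
move=> bWB; have [s1 s2 s3] := coordinates_subset bWB.
have [s1' s2' s3'] := coordinates_subset (latin_bitrade_sym bWB).
by split; apply/eqP; rewrite eqEsubset; apply/andP.
Qed.

Lemma bitrade_card W B : latin_bitrade R C S W B -> #|W| = #|B|.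
Proof.
move=> bWB; have [eqWB _ _] := bitrade_coordinates bWB.
case: bWB => -[/coordinates_inj[injW _ _] /coordinates_inj[injB _ _]] _ _ _.
by rewrite -(card_in_imset injW) eqWB card_in_imset.
Qed.

(** Each projection to two coordinates is injective on [W] and on [B], with the same image, so both
    sums run over the same edges. *)
Lemma bitrade_sum (K : nmodType) W B :
  latin_bitrade R C S W B ->
  [/\ forall h : X -> Y -> K,
        \sum_(t in W) h t.1.1 t.1.2 = \sum_(t in B) h t.1.1 t.1.2,
      forall h : X -> Z -> K,
        \sum_(t in W) h t.1.1 t.2 = \sum_(t in B) h t.1.1 t.2
    & forall h : Y -> Z -> K,
        \sum_(t in W) h t.1.2 t.2 = \sum_(t in B) h t.1.2 t.2].
Proof.
move=> bWB; have [eq1 eq2 eq3] := bitrade_coordinates bWB.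
case: bWB => -[/coordinates_inj[W1 W2 W3] /coordinates_inj[B1 B2 B3]] _ _ _.
have exchange (D : finType) (pi : X * Y * Z -> D) (g : D -> K) :
    {in W &, injective pi} -> {in B &, injective pi} -> pi @: W = pi @: B ->
    \sum_(t in W) g (pi t) = \sum_(t in B) g (pi t).
  by move=> injW injB eqWB; rewrite -(big_imset _ injW) eqWB big_imset.
split=> h.
- exact: (exchange _ _ (fun p => h p.1 p.2) W1 B1 eq1).
- exact: (exchange _ _ (fun p => h p.1 p.2) W2 B2 eq2).
- exact: (exchange _ _ (fun p => h p.1 p.2) W3 B3 eq3).
Qed.

(* Every entry of the Gram matrix counts triples through one vertex or
   through two given vertices, and both parts of a bitrade contain equally
   many of these. *)
Lemma bitrade_gram W B (v w : vertex X Y Z) :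
  latin_bitrade R C S W B ->
  \sum_(t in W) relator t v * relator t w
  = \sum_(t in B) relator t v * relator t w.
Proof.
move=> bWB; have [sum_xy sum_xz sum_yz] := bitrade_sum int bWB.
pose dx (u : vertex X Y Z) x := generator (row_vertex Y Z x) u.
pose dy (u : vertex X Y Z) y := generator (column_vertex X Z y) u.
pose dz (u : vertex X Y Z) z := generator (symbol_vertex X Y z) u.
(* The nine products are grouped so that each sum involves only two coordinates; a square of one
   coordinate joins a pair containing it. *)
have split_sum P : \sum_(t in P) relator t v * relator t w =
    (\sum_(t in P) (dx v t.1.1 * dx w t.1.1 + dx v t.1.1 * dy w t.1.2
                    + dy v t.1.2 * dx w t.1.1 + dy v t.1.2 * dy w t.1.2)
    + \sum_(t in P) (dx v t.1.1 * dz w t.2 + dz v t.2 * dx w t.1.1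
                     + dz v t.2 * dz w t.2))
    + \sum_(t in P) (dy v t.1.2 * dz w t.2 + dz v t.2 * dy w t.1.2).
  rewrite -!big_split /=; apply: eq_bigr => t _.
  have relE u : relator t u = dx u t.1.1 + dy u t.1.2 + dz u t.2.
    by rewrite [relator t u]ffunE [X in (X + _)%R]ffunE.
  by rewrite !relE; ring.
rewrite !split_sum; congr (_ + _ + _).
- exact: (sum_xy (fun x y => dx v x * dx w x + dx v x * dy w y
                             + dy v y * dx w x + dy v y * dy w y)).
- exact: (sum_xz (fun x z => dx v x * dz w z + dz v z * dx w x
                             + dz v z * dz w z)).
- exact: (sum_yz (fun y z => dy v y * dz w z + dz v z * dy w y)).
Qed.

End PairCoordinates.

(** * Connectedness as an induction principle *)

Section Connected.
Variables X Y Z : finType.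
Variables (W B : {set X * Y * Z}).
Hypotheses (bWB : latin_bitrade [set: X] [set: Y] [set: Z] W B).

(** A predicate that agrees on white and black triples sharing an edge is inherited by mates, so its
    triples form a bitrade on the rows, columns and symbols they meet. The triple [t0] makes it
    non-empty. *)
Lemma bitrade_restrict (p : pred (X * Y * Z)) (t0 : X * Y * Z) :
  (forall r r' c s, (r, c, s) \in W -> (r', c, s) \in B ->
     p (r, c, s) = p (r', c, s)) ->
  (forall r c c' s, (r, c, s) \in W -> (r, c', s) \in B ->
     p (r, c, s) = p (r, c', s)) ->
  (forall r c s s', (r, c, s) \in W -> (r, c, s') \in B ->
     p (r, c, s) = p (r, c, s')) ->
  t0 \in W -> p t0 ->
  let W' := [set t in W | p t] in let B' := [set t in B | p t] in
  latin_bitrade [set t.1.1 | t in W'] [set t.1.2 | t in W']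
    [set t.2 | t in W'] W' B'.
Proof.
move=> pr pc ps t0W pt0 W' B'; have bBW := latin_bitrade_sym bWB.
have mem P t : (t \in [set t in P | p t]) = (t \in P) && p t by rewrite inE.
case: (bWB) => -[[_ agrW _ _ _] [_ agrB _ _ _]] _ matesW matesB.
have matesW' : has_unique_mates W' B'.
  move=> r c s; rewrite mem => /andP[tW pt].
  have [[r' [[r'r rB] ur]] [c' [[c'c cB] uc]] [s' [[s's sB] us]]] :=
    matesW _ _ _ tW.
  split; [exists r' | exists c' | exists s'].
  - by split=> [|r2]; rewrite mem;
      [rewrite rB -(pr r r') | case=> ? /andP[? _]; apply: ur].
  - by split=> [|c2]; rewrite mem;
      [rewrite cB -(pc r c c') | case=> ? /andP[? _]; apply: uc].
  - by split=> [|s2]; rewrite mem;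
      [rewrite sB -(ps r c s s') | case=> ? /andP[? _]; apply: us].
have matesB' : has_unique_mates B' W'.
  move=> r c s; rewrite mem => /andP[tW pt].
  have [[r' [[r'r rB] ur]] [c' [[c'c cB] uc]] [s' [[s's sB] us]]] :=
    matesB _ _ _ tW.
  split; [exists r' | exists c' | exists s'].
  - by split=> [|r2]; rewrite mem;
      [rewrite rB (pr r' r) | case=> ? /andP[? _]; apply: ur].
  - by split=> [|c2]; rewrite mem;
      [rewrite cB (pc r c' c) | case=> ? /andP[? _]; apply: uc].
  - by split=> [|s2]; rewrite mem;
      [rewrite sB (ps r c s' s) | case=> ? /andP[? _]; apply: us].
have t0W' : t0 \in W' by rewrite mem t0W.
split=> //; last first.
  split; apply/set0Pn; first by exists t0.
  case: t0 t0W' {t0W pt0} => [[r c] s] /matesW'[[r' [[_ ?] _]] _ _].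
  by exists (r', c, s).
split; split.
- apply/subsetP => -[[r c] s] tW'; rewrite !in_setX -andbA.
  by apply/and3P; split; apply/imsetP; exists (r, c, s).
- by move=> t u; rewrite !mem => /andP[tW _] /andP[uW _]; apply: agrW.
- by move=> r /imsetP[[[? c] s] tW' ->]; exists c, s.
- by move=> c /imsetP[[[r ?] s] tW' ->]; exists r, s.
- by move=> s /imsetP[[[r c] ?] tW' ->]; exists r, c.
- apply/subsetP => -[[r c] s] tB'; rewrite !in_setX /=.
  have [[r' [[_ rW] _]] [c' [[_ cW] _]] _] := matesB' _ _ _ tB'.
  apply/andP; split; first (apply/andP; split).
  + by apply/imsetP; exists (r, c', s).
  + by apply/imsetP; exists (r', c, s).
  + by apply/imsetP; exists (r, c', s).
- by move=> t u; rewrite !mem => /andP[tB _] /andP[uB _]; apply: agrB.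
- move=> _ /imsetP[[[r c] s] /matesW'[_ _ [s' [[_ ?] _]]] ->].
  by exists c, s'.
- move=> _ /imsetP[[[r c] s] /matesW'[_ _ [s' [[_ ?] _]]] ->].
  by exists r, s'.
- move=> _ /imsetP[[[r c] s] /matesW'[_ [c' [[_ ?] _]] _] ->].
  by exists r, c'.
Qed.

Hypothesis conWB : connected_bitrade W B.

(** A white triple violating [p] would make the restriction to [p] a smaller bitrade; its row mate
    shows that black triples are lost as well. *)
Lemma connected_ind (p : pred (X * Y * Z)) (t0 : X * Y * Z) :
  (forall r r' c s, (r, c, s) \in W -> (r', c, s) \in B ->
     p (r, c, s) = p (r', c, s)) ->
  (forall r c c' s, (r, c, s) \in W -> (r, c', s) \in B ->
     p (r, c, s) = p (r, c', s)) ->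
  (forall r c s s', (r, c, s) \in W -> (r, c, s') \in B ->
     p (r, c, s) = p (r, c, s')) ->
  t0 \in W -> p t0 -> {in W, forall t, p t}.
Proof.
move=> pr pc ps t0W pt0 t tW; apply: contrapT => /negP npt; apply: conWB.
pose W' := [set t in W | p t]; pose B' := [set t in B | p t].
exists [set t.1.1 | t in W'], [set t.1.2 | t in W'], [set t.2 | t in W'].
exists W', B'; split; first exact: (bitrade_restrict pr pc ps t0W pt0).
  apply/properP; split; first by apply/subsetP => u; rewrite inE => /andP[].
  by exists t; rewrite // inE tW.
apply/properP; split; first by apply/subsetP => u; rewrite inE => /andP[].
case: t tW npt => [[r c] s] tW npt.
have [[r' _ rB] _ _] := bitrade_mates bWB tW.
by exists (r', c, s); rewrite // inE rB -(pr r).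
Qed.

End Connected.

(** * The vertex count from the Euler characteristic *)

Section SphereCount.
Variables X Y Z : finType.
Variables (R : {set X}) (C : {set Y}) (S : {set Z}) (W B : {set X * Y * Z}).
Hypothesis bWB : latin_bitrade R C S W B.

Definition edge_xy (t : X * Y * Z) : {set vertex X Y Z} :=
  [set row_vertex Y Z t.1.1; column_vertex X Z t.1.2].
Definition edge_xz (t : X * Y * Z) : {set vertex X Y Z} :=
  [set row_vertex Y Z t.1.1; symbol_vertex X Y t.2].
Definition edge_yz (t : X * Y * Z) : {set vertex X Y Z} :=
  [set column_vertex X Z t.1.2; symbol_vertex X Y t.2].

(** Each white triple has three edges, one of each type, and distinct white triples share none. *)
Lemma edges_card : (3 * #|W| <= #|edges W|)%N.
Proof.
case: (bWB) => -[/coordinates_inj[W1 W2 W3] _] _ _ _.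
have inj1 : {in W &, injective edge_xy}.
  move=> t u tW uW /setP tu; apply: W1 => //; rewrite /row_column.
  have := tu (row_vertex Y Z t.1.1); have := tu (column_vertex X Z t.1.2).
  by rewrite !inE !eqxx !eqE /= !eqE /= orbF => /esym/eqP -> /esym/eqP ->.
have inj2 : {in W &, injective edge_xz}.
  move=> t u tW uW /setP tu; apply: W2 => //; rewrite /row_symbol.
  have := tu (row_vertex Y Z t.1.1); have := tu (symbol_vertex X Y t.2).
  by rewrite !inE !eqxx !eqE /= !eqE /= orbF => /esym/eqP -> /esym/eqP ->.
have inj3 : {in W &, injective edge_yz}.
  move=> t u tW uW /setP tu; apply: W3 => //; rewrite /column_symbol.
  have := tu (column_vertex X Z t.1.2); have := tu (symbol_vertex X Y t.2).
  by rewrite !inE !eqxx !eqE /= !eqE /= orbF => /esym/eqP -> /esym/eqP ->.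
have sub : edge_xy @: W :|: (edge_xz @: W :|: edge_yz @: W) \subset edges W.
  apply/subsetP => e; rewrite !inE => /or3P[] /imsetP[t tW ->];
    rewrite cards2; (apply/andP; split; first by []);
    apply/exists_inP; exists t => //; apply/subsetP => v;
    by rewrite !inE => /orP[] ->; rewrite ?orbT.
apply: leq_trans (subset_leq_card sub).
have disj (e e' : X * Y * Z -> {set vertex X Y Z}) :
    (forall t u, e t <> e' u) -> [disjoint e @: W & e' @: W].
  move=> ne; rewrite -setI_eq0; apply/eqP/setP => f; rewrite !inE.
  by apply/negP => /andP[/imsetP[t _ ->] /imsetP[u _] /ne].
rewrite !cardsU !disjoint_setI0 ?cards0.
- by rewrite !subn0 !card_in_imset // !mulSn mul0n addn0.
- rewrite -setI_eq0 setIUr setU_eq0 !setI_eq0.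
  apply/andP; split; apply: disj => t u.
    by move/setP/(_ (column_vertex X Z t.1.2)); rewrite !inE eqxx orbT.
  by move/setP/(_ (row_vertex Y Z t.1.1)); rewrite !inE eqxx.
- by apply: disj => t u /setP/(_ (row_vertex Y Z t.1.1)); rewrite !inE eqxx.
Qed.

(** V = E - F + 2 with E >= 3 |W| and F <= |W| + |B| = 2 |W|. *)
Lemma sphere_vertex_bound :
  surface_is_sphere W B -> (#|W| + 2 <= #|vertex X Y Z|)%N.
Proof.
move=> sphere; have := edges_card; rewrite /surface_is_sphere in sphere.
have: (#|faces W B| <= #|W| + #|B|)%N.
  by apply: leq_trans (leq_imset_card _ _) _; rewrite cardsU leq_subr.
rewrite -(bitrade_card bWB); lia.
Qed.

End SphereCount.

(** * Torsion in the presented group *)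

Section Torsion.
Variables X Y Z : finType.
Implicit Types W P : {set X * Y * Z}.

Lemma relationsP P (x : {ffun vertex X Y Z -> int}) :
  reflect (exists a : X * Y * Z -> int, x = \sum_(t in P) relator t *~ a t)
    (x \in relations P).
Proof. exact: asboolP. Qed.

Lemma relator_relations P t : t \in P -> relator t \in relations P.
Proof.
move=> tP; apply/relationsP; exists (fun u => (u == t)%:R).
rewrite (bigD1 t) //= eqxx big1 ?addr0 // => u /andP[_ /negbTE ->].
by rewrite mulr0z.
Qed.

Lemma pi_eq0 P (x : {ffun vertex X Y Z -> int}) :
  (\pi_(presented_group P) x == 0) = (x \in relations P).
Proof. by rewrite -[x in RHS]subr0 Quotient.idealrBE raddf0. Qed.

(** The representatives in the free group of the torsion elements of the presented group. *)
Definition torsion_relation P (x : {ffun vertex X Y Z -> int}) :=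
  exists2 n : nat, (0 < n)%N & x *+ n \in relations P.

Lemma canonical_group_surj P (x : {ffun vertex X Y Z -> int}) :
  torsion_relation P x ->
  exists u : canonical_group P, canonical_val u = \pi_(presented_group P) x.
Proof.
case=> n n_gt0 xn; have tor : \pi_(presented_group P) x \in @torsion X Y Z P.
  by apply/asboolP; exists n => //; apply/eqP; rewrite -raddfMn pi_eq0.
by exists (CanonicalGroup tor).
Qed.

Lemma canonical_group_repr P (u : canonical_group P) :
  exists2 x, torsion_relation P x & canonical_val u = \pi_(presented_group P) x.
Proof.
exists (repr (canonical_val u)); last by rewrite reprK.
case: u => u /= /asboolP[n n_gt0 un]; exists n => //.
by rewrite -pi_eq0 raddfMn /= reprK un.
Qed.

Lemma two_torsion P k (f : {additive canonical_group P -> {ffun 'I_k -> 'Z_2}})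
    x : injective f -> torsion_relation P x -> x *+ 2 \in relations P.
Proof.
move=> inj_f /canonical_group_surj[u ux].
have u2 : u *+ 2 = 0.
  apply: inj_f; rewrite raddfMn raddf0; apply/ffunP => i.
  rewrite ffunMnE ffunE; by case: (f u i) => -[|[|[]]] // ?; apply: val_inj.
rewrite -pi_eq0 raddfMn /= -ux; apply/eqP.
by have /(congr1 (@canonical_val _ _ _ _)) := u2.
Qed.

End Torsion.

(** * Incidence matrices *)

Lemma common_denominator (I : finType) (q : I -> rat) :
  exists2 n : nat, (0 < n)%N &
    exists a : I -> int, forall i, q i * n%:R = (a i)%:~R.
Proof.
exists (\prod_i `|denq (q i)|)%N.
  by rewrite prodn_gt0 // => i; rewrite absz_gt0 denq_neq0.
exists (fun i => numq (q i) * (\prod_(j | j != i) `|denq (q j)|)%N%:Z) => i.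
rewrite (bigD1 i) //= natrM mulrA rmorphM /=; congr (_ * _).
rewrite natr_absz normr_denq -{1}[q i]divq_num_den divfK //.
by rewrite intr_eq0 denq_neq0.
Qed.

Section Incidence.
Variables X Y Z : finType.
Local Notation T := (X * Y * Z)%type.
Local Notation vert := (vertex X Y Z).
Implicit Types P Q : {set T}.

Definition incidence P : 'M[rat]_(#|P|, #|vert|) :=
  \matrix_(i, j) (relator (enum_val i) (enum_val j))%:~R.

Definition coef_matrix P Q (m : T -> T -> int) : 'M[rat]_(#|P|, #|Q|) :=
  \matrix_(i, j) (m (enum_val i) (enum_val j))%:~R.

(** Passes between integral relations, where the combinatorics takes place, and rational matrices,
    where linear algebra applies. *)
Lemma coef_matrix_incidence P Q (m : T -> T -> int) (c : int) :
  coef_matrix P Q m *m incidence Q = c%:~R *: incidence P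
  <-> {in P, forall t, \sum_(u in Q) relator u *~ m t u = relator t *~ c}.
Proof.
split=> [/matrixP eqM t tP|rel].
  apply/ffunP => v; rewrite sum_ffunE ffunMzE.
  apply: (@intr_inj rat).
  have := eqM (enum_rank_in tP t) (enum_rank v); rewrite !mxE.
  rewrite !enum_rankK_in // -rmorphM mulrzz mulrC => <-.
  rewrite big_enum_val rmorph_sum; apply: eq_bigr => i _.
  by rewrite ffunMzE mulrzz !mxE !enum_rankK_in // rmorphM mulrC.
apply/matrixP => i j; rewrite !mxE -rmorphM.
have /ffunP/(_ (enum_val j)) := rel _ (enum_valP i).
rewrite sum_ffunE ffunMzE mulrzz mulrC => <-.
rewrite [in RHS]big_enum_val rmorph_sum; apply: eq_bigr => k _.
by rewrite ffunMzE mulrzz !mxE rmorphM mulrC.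
Qed.

Lemma mul_incidence P (u : 'cV[rat]_#|vert|) i :
  (incidence P *m u) i 0 = face_sum (fun v => u (enum_rank v) 0) (enum_val i).
Proof.
rewrite mxE -sum_relator (reindex _ (onW_bij _ (@enum_val_bij vert))) /=.
by apply: eq_bigr => j _; rewrite mxE enum_valK.
Qed.

Variables W B : {set T}.
Hypothesis bWB : latin_bitrade [set: X] [set: Y] [set: Z] W B.

Lemma incidence_gram :
  (incidence W)^T *m incidence W = (incidence B)^T *m incidence B.
Proof.
apply/matrixP => i j; rewrite !mxE.
have gram P : \sum_k (incidence P)^T i k * incidence P k j =
    (\sum_(t in P) relator t (enum_val i) * relator t (enum_val j))%:~R.
  rewrite [in RHS]big_enum_val rmorph_sum; apply: eq_bigr => k _.
  by rewrite !mxE rmorphM.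
by rewrite !gram (bitrade_gram _ _ bWB).
Qed.

(** Equal Gram matrices make the black row a rational combination of white rows; a common
    denominator turns it into an integral relation. *)
Lemma torsion_relator b : b \in B -> torsion_relation W (relator b).
Proof.
move=> bB; have /mulmxKpV := gram_submx incidence_gram.
move=> /matrixP eqB.
pose q w := (incidence B *m pinvmx (incidence W)) (enum_rank_in bB b) w.
have [n n_gt0 [a qa]] := common_denominator q; exists n => //.
have [w0 w0W] : exists w, w \in W.
  by case: (bWB) => _ [/set0Pn].
apply/relationsP; exists (fun t => a (enum_rank_in w0W t)).
apply/ffunP => v; apply: (@intr_inj rat).
rewrite ffunMnE sum_ffunE rmorphMn /= -mulr_natr.
have := eqB (enum_rank_in bB b) (enum_rank v).
rewrite [RHS]mxE !enum_rankK_in // => <-.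
rewrite [in RHS]big_enum_val mxE mulr_suml rmorph_sum; apply: eq_bigr => i _.
rewrite ffunMzE mulrzz rmorphM /= enum_valK_in -qa /q mxE mxE enum_rankK.
by rewrite [RHS]mulrC mulrAC.
Qed.

Hypothesis conWB : connected_bitrade W B.

(** A white and a black triple on a common edge have zero sums, hence equal values at their opposite
    vertices. Connectedness spreads this to all triples. *)
Lemma face_sum_const (f : vert -> rat) t0 : t0 \in W ->
  {in W, forall t, face_sum f t = 0} -> {in B, forall t, face_sum f t = 0} ->
  [/\ forall r, f (row_vertex Y Z r) = f (row_vertex Y Z t0.1.1),
      forall c, f (column_vertex X Z c) = f (column_vertex X Z t0.1.2)
    & forall s, f (symbol_vertex X Y s) = f (symbol_vertex X Y t0.2)].
Proof.
move=> t0W fW fB.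
pose p (t : T) := [&& f (row_vertex Y Z t.1.1) == f (row_vertex Y Z t0.1.1),
  f (column_vertex X Z t.1.2) == f (column_vertex X Z t0.1.2)
  & f (symbol_vertex X Y t.2) == f (symbol_vertex X Y t0.2)].
have pW : {in W, forall t, p t}.
  apply: (connected_ind bWB conWB _ _ _ t0W); rewrite /p ?eqxx //=.
  - move=> r r' c s /fW + /fB; rewrite /face_sum /= => <- /addIr/addIr ->; done.
  - move=> r c c' s /fW + /fB; rewrite /face_sum /= => <- /addIr/addrI ->; done.
  - by move=> r c s s' /fW + /fB; rewrite /face_sum /= => <- /addrI ->.
case: (bWB) => -[[_ _ rW cW sW] _] _ _ _; split.
- by move=> r; have [c [s /pW/and3P[/eqP]]] := rW r (in_setT r).
- by move=> c; have [r [s /pW/and3P[_ /eqP]]] := cW c (in_setT c).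
- by move=> s; have [r [c /pW/and3P[_ _ /eqP]]] := sW s (in_setT s).
Qed.

Hypothesis vertW : (#|W| + 2 <= #|vert|)%N.

(** A kernel vector of the incidence matrix A is constant on rows, on columns and on symbols, and
    the three constants sum to 0. So the kernel has dimension at most 2, and rank A >= V - 2 >=
    |W|. *)
Lemma incidence_row_free : row_free (incidence W).
Proof.
have [t0 t0W] : exists w, w \in W by case: (bWB) => _ [/set0Pn].
have incK : incidence W *m cokermx (incidence W) = 0 := mulmx_coker _.
have := mxrank_coker (incidence W).
move: (cokermx _) incK => K incK rankK.
(* The columns of [U] are the functions (1, 0, -1) and (0, 1, -1) on (rows, columns, symbols); [N]
   holds the coordinates of the kernel vectors, read off at the row and column of [t0]. *)
pose U : 'M[rat]_(#|vert|, 2) := \matrix_(i, j)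
  match enum_val i with
  | inl (inl _) => (j == 0)%:R
  | inl (inr _) => (j == 1)%:R
  | inr _ => -1
  end.
pose N : 'M[rat]_(2, #|vert|) := \matrix_(i, j)
  K (enum_rank (if i == 0 then row_vertex Y Z t0.1.1
                else column_vertex X Z t0.1.2)) j.
have KUN : K = U *m N.
  apply/matrixP => i j; rewrite mxE big_ord_recl big_ord1 !mxE /=.
  pose f v := K (enum_rank v) j.
  have Kj0 : incidence W *m col j K = 0.
    by rewrite colE mulmxA incK mul0mx.
  have fW : {in W, forall t, face_sum f t = 0}.
    move=> t tW; move/matrixP/(_ (enum_rank_in tW t) 0): Kj0.
    by rewrite mul_incidence enum_rankK_in // !mxE /face_sum !mxE.
  have fB : {in B, forall t, face_sum f t = 0}.
    move=> t tB.
    have /matrixP/(_ (enum_rank_in tB t) 0) :=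
      gram_mulmx_eq0 incidence_gram Kj0.
    by rewrite mul_incidence enum_rankK_in // !mxE /face_sum !mxE.
  have [fr fc fs] := face_sum_const t0W fW fB.
  have := fW _ t0W; rewrite /face_sum.
  have -> : K i j = f (enum_val i) by rewrite /f enum_valK.
  case: (enum_val i) => [[r|c]|s] /= sum0.
  - by rewrite -[inl (inl r)]/(row_vertex Y Z r) fr mul1r mul0r addr0.
  - by rewrite -[inl (inr c)]/(column_vertex X Z c) fc mul0r add0r mul1r.
  - rewrite -[inr s]/(symbol_vertex X Y s) fs !mulN1r -opprD.
    by apply/eqP; rewrite -addr_eq0 addrC sum0.
have := mulmx_max_rank U N; rewrite -KUN rankK => rank_le2.
rewrite /row_free eqn_leq rank_leq_row /=.
rewrite -(leq_add2r 2); apply: leq_trans vertW _.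
by rewrite -leq_subLR.
Qed.

End Incidence.

(** * Intercalates *)

(** For each choice of two coordinates from the given pairs, one of the four triples has them, and
    no other triple of [P] can. *)
Lemma intercalate_closed (X Y Z : finType) (R : {set X}) (C : {set Y})
    (S : {set Z}) (P : {set X * Y * Z}) r c s r' c' s' :
  partial_latin_square R C S P ->
  (r, c, s) \in P -> (r, c', s') \in P -> (r', c, s') \in P ->
  (r', c', s) \in P ->
  [/\ forall x y z, (x, y, z) \in P -> y \in pred2 c c' -> z \in pred2 s s' ->
        x \in pred2 r r',
      forall x y z, (x, y, z) \in P -> x \in pred2 r r' -> z \in pred2 s s' ->
        y \in pred2 c c'
    & forall x y z, (x, y, z) \in P -> x \in pred2 r r' -> y \in pred2 c c' ->
        z \in pred2 s s'].
Proof.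
move=> plsP P1 P2 P3 P4.
have eqP t u : t \in P -> u \in P -> (1 < agreement t u)%N -> t = u.
  by move=> tP uP; apply: agreement_inj plsP tP uP.
split=> x y z tP /pred2P[] ? /pred2P[] ?; subst; rewrite inE /=;
  let close H := solve
    [ move: (eqP _ _ tP H); rewrite /agreement /= !eqxx;
      case: (_ =P _) => [_ _|ne /(_ isT) [/ne//]]; rewrite ?orbT // ] in
  first [close P1 | close P2 | close P3 | close P4].
Qed.

Section Intercalate.
Variables X Y Z : finType.
Local Notation T := (X * Y * Z)%type.
Local Notation vert := (vertex X Y Z).
Variables W B : {set T}.
Hypothesis bWB : latin_bitrade [set: X] [set: Y] [set: Z] W B.
Hypothesis conWB : connected_bitrade W B.
Hypothesis vertW : (#|W| + 2 <= #|vert|)%N.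
Hypothesis exponent2 :
  forall x, torsion_relation W x -> x *+ 2 \in relations W.

(** Doubling a black relator kills its torsion, which gives [M]. The norms 4 are the diagonal
    entries of M M^T and M^T M. *)
Lemma orthogonal_coefficients : exists m : T -> T -> int,
  [/\ {in B, forall b, \sum_(w in W) relator w *~ m b w = relator b *~ 2},
      {in W, forall w, \sum_(b in B) relator b *~ m b w = relator w *~ 2},
      {in B, forall b, \sum_(w in W) m b w ^+ 2 = 4}
    & {in W, forall w, \sum_(b in B) m b w ^+ 2 = 4}].
Proof.
have /choice[m rel] b : exists a : T -> int,
    b \in B -> \sum_(w in W) relator w *~ a w = relator b *~ 2.
  case: (boolP (b \in B)) => [bB|_]; last by exists (fun=> 0).
  have /relationsP[a def_b] := exponent2 (torsion_relator bWB bB).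
  by exists a => _; rewrite -def_b.
exists m; pose M := coef_matrix B W m.
have MA : M *m incidence W = 2%:~R *: incidence B.
  by apply/coef_matrix_incidence => b; apply: rel.
have gram := incidence_gram bWB.
have four : 2%:~R ^+ 2 = 4 :> rat by [].
have MtM : M^T *m M = 4%:M.
  rewrite -four; apply: gram_coef_orthogonal gram (esym MA).
  exact: (incidence_row_free bWB conWB vertW).
have MMt : M *m M^T = 4%:M.
  rewrite -{1}[M]trmxK; apply: mulmx_scalarC; rewrite ?trmxK //.
  exact: bitrade_card bWB.
have MtA : coef_matrix W B (fun w b => m b w) *m incidence B
    = 2%:~R *: incidence W.
  have -> : coef_matrix W B (fun w b => m b w) = M^T.
    by apply/matrixP => i j; rewrite !mxE.
  (* With A and A' the incidence matrices of [W] and [B]: 2 M^T A' = M^T M A = 4 A, and a factor 2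
     is cancelled. *)
  apply: (scalerI (a := 2%:~R : rat)) => //.
  by rewrite scalemxAr -MA mulmxA MtM mul_scalar_mx scalerA.
split.
- by move=> b; apply: rel.
- by move/coef_matrix_incidence: MtA => relW w wW; apply: relW.
- move=> b bB; apply: (@intr_inj rat).
  move/matrixP/(_ (enum_rank_in bB b) (enum_rank_in bB b)): MMt.
  rewrite !mxE eqxx mulr1n => sum4.
  rewrite rmorph_nat -[RHS]sum4 big_enum_val rmorph_sum.
  apply: eq_bigr => i _.
  by rewrite !mxE enum_rankK_in // expr2 rmorphM.
- move=> w wW; apply: (@intr_inj rat).
  move/matrixP/(_ (enum_rank_in wW w) (enum_rank_in wW w)): MtM.
  rewrite !mxE eqxx mulr1n => sum4.
  rewrite rmorph_nat -[RHS]sum4 big_enum_val rmorph_sum.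
  apply: eq_bigr => i _.
  by rewrite !mxE enum_rankK_in // expr2 rmorphM.
Qed.

Lemma exists_intercalate : exists r c s r' c' s',
  [/\ (r, c, s) \in W, (r, c', s') \in W, (r', c, s') \in W
    & (r', c', s) \in W] /\
  [/\ (r', c', s') \in B, (r', c, s) \in B, (r, c', s) \in B
    & (r, c, s') \in B].
Proof.
have [m [relB relW normB normW]] := orthogonal_coefficients.
have [[[r c] s] aW] : exists w, w \in W by case: (bWB) => _ [/set0Pn].
have aB := bitrade_disjoint bWB aW.
have [[[r' c'] s'] qB mq] := exists_coef_neg aB (normW _ aW) (relW _ aW).
have qW := bitrade_disjoint (latin_bitrade_sym bWB) qB.
exists r, c, s, r', c', s'.
have [_ [B1 B2 B3]] := coef_neg_mates aB (normW _ aW) (relW _ aW) erefl qB mq.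
(* The same negative entry is now read in the row of the black triple instead of the column of the
   white one, so the two triples exchange roles. *)
have [_ [W1 W2 W3]] := coef_neg_mates qW (normB _ qB) (relB _ qB) erefl aW mq.
by split.
Qed.

(** Lying inside the intercalate passes across every shared edge, so by connectedness all white
    triples lie there, and they meet every vertex. *)
Lemma vertices_of_intercalate r c s r' c' s' :
  [/\ (r, c, s) \in W, (r, c', s') \in W, (r', c, s') \in W
    & (r', c', s) \in W] ->
  [/\ (r', c', s') \in B, (r', c, s) \in B, (r, c', s) \in B
    & (r, c, s') \in B] ->
  [/\ forall x, x \in pred2 r r', forall y, y \in pred2 c c'
    & forall z, z \in pred2 s s'].
Proof.
move=> [W1 W2 W3 W4] [B1 B2 B3 B4].
case: (bWB) => -[plsW plsB] _ _ _; have [_ _ rW cW sW] := plsW.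
pose p (t : T) :=
  [&& t.1.1 \in pred2 r r', t.1.2 \in pred2 c c' & t.2 \in pred2 s s'].
have [Wx Wy Wz] := intercalate_closed plsW W1 W2 W3 W4.
(* The black half is an intercalate with [r] and [r'] exchanged; [swap] undoes the exchange. *)
have [Bx By Bz] := intercalate_closed plsB B2 B1 B4 B3.
have swap x : (x \in pred2 r' r) = (x \in pred2 r r') by rewrite !inE orbC.
have pW : {in W, forall t, p t}.
  have W0 : p (r, c, s) by rewrite /p /= !inE !eqxx.
  apply: (connected_ind bWB conWB _ _ _ W1 W0); rewrite /p /=.
  - move=> x x' y z tW tB; apply: andb_id2r => /andP[y_in z_in].
    by rewrite (Wx _ _ _ tW) // -swap (Bx _ _ _ tB).
  - move=> x y y' z tW tB; apply: andb_id2l => x_in; apply: andb_id2r => z_in.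
    by rewrite (Wy _ _ _ tW) // (By _ _ _ tB) ?swap.
  - move=> x y z z' tW tB; apply: andb_id2l => x_in; apply: andb_id2l => y_in.
    by rewrite (Wz _ _ _ tW) // (Bz _ _ _ tB) ?swap.
split.
- by move=> x; have [y [z /pW/and3P[]]] := rW x (in_setT x).
- by move=> y; have [x [z /pW/and3P[]]] := cW y (in_setT y).
- by move=> z; have [x [y /pW/and3P[]]] := sW z (in_setT z).
Qed.

End Intercalate.

(** * The torsion of an intercalate has order at most 2 *)

Section IntercalateTorsion.
Variables X Y Z : finType.
Local Notation vert := (vertex X Y Z).
Implicit Types (P : {set X * Y * Z}) (x : {ffun vert -> int}).

(** Every relator contains exactly one row, one column and one symbol. *)
Lemma relations_sums P x : x \in relations P ->
  \sum_r x (row_vertex Y Z r) = \sum_c x (column_vertex X Z c) /\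
  \sum_r x (row_vertex Y Z r) = \sum_s x (symbol_vertex X Y s).
Proof.
case/relationsP=> a ->.
have sum_rel (V : finType) (i : V -> vert) (pi : X * Y * Z -> V) :
    (forall t v, relator t (i v) = (v == pi t)%:R) ->
    \sum_v (\sum_(t in P) relator t *~ a t) (i v) = \sum_(t in P) a t.
  move=> rel; under eq_bigr do rewrite sum_ffunE.
  rewrite exchange_big; apply: eq_bigr => t _.
  rewrite (bigD1 (pi t)) //= ffunMzE rel eqxx mulrzz mul1r big1 ?addr0 // => v.
  by rewrite ffunMzE rel => /negbTE ->; rewrite mul0rz.
rewrite (sum_rel _ _ _ (@relator_row X Y Z)).
rewrite (sum_rel _ _ _ (@relator_column X Y Z)).
by rewrite (sum_rel _ _ _ (@relator_symbol X Y Z)).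
Qed.

Lemma torsion_sums P x : torsion_relation P x ->
  \sum_r x (row_vertex Y Z r) = \sum_c x (column_vertex X Z c) /\
  \sum_r x (row_vertex Y Z r) = \sum_s x (symbol_vertex X Y s).
Proof.
case=> n n_gt0 /relations_sums.
have sumMn (V : finType) (i : V -> vert) :
    \sum_v (x *+ n) (i v) = (\sum_v x (i v)) *+ n.
  by rewrite -sumrMnl; apply: eq_bigr => v _; rewrite ffunMnE.
rewrite !sumMn => -[eq_rc eq_rs].
by split; apply: (pmulrnI n_gt0).
Qed.

(** The three coefficient sums of [x] coincide, so one multiple of a base relator brings all of them
    to 0; what remains is a combination of differences of generators of the same kind. *)
Lemma torsion_decomposition P x r c s : torsion_relation P x ->
  x - relator (r, c, s) *~ \sum_i x (row_vertex Y Z i) =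
    \sum_i (generator (row_vertex Y Z i) - generator (row_vertex Y Z r))
      *~ x (row_vertex Y Z i)
    + \sum_i (generator (column_vertex X Z i) - generator (column_vertex X Z c))
      *~ x (column_vertex X Z i)
    + \sum_i (generator (symbol_vertex X Y i) - generator (symbol_vertex X Y s))
      *~ x (symbol_vertex X Y i).
Proof.
move=> /torsion_sums[eq_rc eq_rs].
have sum_gen (V : finType) (i : V -> vert) v0 :
    \sum_v (generator (i v) - generator (i v0)) *~ x (i v) =
    \sum_v generator (i v) *~ x (i v) - generator (i v0) *~ \sum_v x (i v).
  by rewrite mulrz_sumr -sumrB; apply: eq_bigr => v _; rewrite mulrzBl.
rewrite (sum_gen _ (row_vertex Y Z)) (sum_gen _ (column_vertex X Z)).
rewrite (sum_gen _ (@symbol_vertex X Y Z)) -eq_rc -eq_rs.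
have {1}-> : x = \sum_v generator v *~ x v.
  apply/ffunP => w; rewrite sum_ffunE (bigD1 w) //= ffunMzE ffunE eqxx big1.
    by rewrite addr0 mulrzz mul1r.
  by move=> v vw; rewrite ffunMzE ffunE eq_sym (negbTE vw) mul0rz.
rewrite /relator !mulrzDl /= !big_sumType /=.
rewrite -[LHS]/(\sum_i generator (row_vertex Y Z i) *~ x (row_vertex Y Z i)
  + \sum_i generator (column_vertex X Z i) *~ x (column_vertex X Z i)
  + \sum_i generator (symbol_vertex X Y i) *~ x (symbol_vertex X Y i) - _).
by rewrite !opprD addrACA; congr (_ + _); apply: addrACA.
Qed.

(** Modulo the relations [dr], [dc] and [ds] are pairwise opposite. Hence [dc] and [ds] equal -[dr],
    and 2 [dr] vanishes, so each torsion element is 0 or [dr] according to the parity of its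
    multiple. *)
Lemma intercalate_torsion P r c s r' c' s' :
  [/\ (r, c, s) \in P, (r, c', s') \in P, (r', c, s') \in P
    & (r', c', s) \in P] ->
  [/\ forall i, i \in pred2 r r', forall j, j \in pred2 c c'
    & forall l, l \in pred2 s s'] ->
  exists d, forall x, torsion_relation P x ->
    x \in relations P \/ x - d \in relations P.
Proof.
move=> [P1 P2 P3 P4] [allX allY allZ].
pose dr : {ffun vert -> int} :=
  generator (row_vertex Y Z r') - generator (row_vertex Y Z r).
pose dc : {ffun vert -> int} :=
  generator (column_vertex X Z c') - generator (column_vertex X Z c).
pose ds : {ffun vert -> int} :=
  generator (symbol_vertex X Y s') - generator (symbol_vertex X Y s).
have relB t u : t \in P -> u \in P -> relator t - relator u \in relations P.
  by move=> tP uP; rewrite rpredB ?relator_relations.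
have drc : dr + dc \in relations P.
  rewrite (_ : _ + _ = relator (r', c', s) - relator (r, c, s)) ?relB //.
  by apply/ffunP => v; rewrite !ffunE; ring.
have drs : dr + ds \in relations P.
  rewrite (_ : _ + _ = relator (r', c, s') - relator (r, c, s)) ?relB //.
  by apply/ffunP => v; rewrite !ffunE; ring.
have dcs : dc + ds \in relations P.
  rewrite (_ : _ + _ = relator (r, c', s') - relator (r, c, s)) ?relB //.
  by apply/ffunP => v; rewrite !ffunE; ring.
have dr2 : dr *+ 2 \in relations P.
  rewrite (_ : _ *+ 2 = dr + dc + (dr + ds) - (dc + ds)).
    exact: rpredB (rpredD drc drs) dcs.
  by apply/ffunP => v; rewrite ffunMnE !ffunE; ring.
pose multiple (y : {ffun vert -> int}) := exists n, y - dr *~ n \in relations P.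
have mult0 : multiple 0 by exists 0; rewrite mulr0z subr0 rpred0.
have multD y z : multiple y -> multiple z -> multiple (y + z).
  move=> [m ym] [n zn]; exists (m + n).
  by rewrite mulrzDr opprD addrACA rpredD.
have multM y n : multiple y -> multiple (y *~ n).
  by move=> [m ym]; exists (m * n); rewrite mulrzA -mulrzBl rpredMz.
have multr i : multiple (generator (row_vertex Y Z i)
                         - generator (row_vertex Y Z r)).
  have /pred2P[-> | ->] := allX i; first by rewrite subrr.
  by exists 1; rewrite subrr rpred0.
have multc i : multiple (generator (column_vertex X Z i)
                         - generator (column_vertex X Z c)).
  have /pred2P[-> | ->] := allY i; first by rewrite subrr.
  (* The multiple is -1 because [dr + dc] is a relation. *)
  by exists (-1); rewrite mulrN1z opprK addrC.
have mults i : multiple (generator (symbol_vertex X Y i)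
                         - generator (symbol_vertex X Y s)).
  have /pred2P[-> | ->] := allZ i; first by rewrite subrr.
  by exists (-1); rewrite mulrN1z opprK addrC.
exists dr => x /(torsion_decomposition r c s).
set k := \sum_i _ => /(canRL (subrK _)) x_eq.
have [n xn] : multiple x.
  rewrite x_eq; apply: (multD); last first.
    by exists 0; rewrite mulr0z subr0 rpredMz ?relator_relations.
  by apply: (multD); [apply: (multD)|];
    apply: big_ind => // i _; apply: multM.
have xE : x = (x - dr *~ n) + dr *~ n by rewrite subrK.
have drn m : dr *~ (m * 2) \in relations P.
  by rewrite mulrC mulrzA rpredMz.
have /orP[/eqP n2|/eqP n2] : (n == (n %/ 2)%Z * 2) || (n == (n %/ 2)%Z * 2 + 1).
  lia.
- by left; rewrite xE rpredD // n2.
- right; rewrite xE -addrA rpredD // n2 mulrzDr mulr1z addrK //.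
Qed.

End IntercalateTorsion.

(** * Two distinct unit vectors against a single nonzero torsion class *)

Theorem theorem1p4 (k : nat) (hk : (2 <= k)%N) :
  ~ exists (R C S : finType) (W B : {set R * C * S}),
      spherical_bitrade W B /\
      zmod_isomorphic (canonical_group W) {ffun 'I_k -> 'Z_2}.
Proof.
move=> [R [C [S [W [B [[bWB conWB _ sphere] [f bij_f]]]]]]].
have vertW := sphere_vertex_bound bWB sphere.
have exponent2 x := @two_torsion _ _ _ W k f x (bij_inj bij_f).
have [r [c [s [r' [c' [s' [Wq Bq]]]]]]] :=
  exists_intercalate bWB conWB vertW exponent2.
have [d dP] := intercalate_torsion Wq (vertices_of_intercalate bWB conWB Wq Bq).
(* All nonzero elements of the canonical group coincide with the class of [d]. *)
have val0d (u : canonical_group W) : u != 0 ->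
    canonical_val u = \pi_(presented_group W) d.
  have [x /dP[x0|xd] ux] := canonical_group_repr u => [/eqP[]|_].
    by apply: val_inj; rewrite /= ux; apply/eqP; rewrite pi_eq0.
  by rewrite ux; apply/eqP; rewrite -subr_eq0 -raddfB pi_eq0.
case: bij_f => g fK gK.
pose e (i : 'I_k) : {ffun 'I_k -> 'Z_2} := [ffun j => (j == i)%:R].
have ge0 i : g (e i) != 0.
  apply: contraTneq isT => /(congr1 f); rewrite gK raddf0 => /ffunP/(_ i).
  by rewrite !ffunE eqxx.
(* The indices are 0 and 1, available since k >= 2; the two unit vectors differ at index 1. *)
have : g (e (Ordinal (ltnW hk))) = g (e (Ordinal hk)).
  by apply: val_inj; rewrite /= !val0d.
by move=> /(can_inj gK)/ffunP/(_ (Ordinal hk)); rewrite !ffunE eqxx.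
Qed.
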